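(* Greedy BST satisfies the geometric access lemma: there is an absolute constant $c$ such that for every $n$, every height diagram $h:[n]\to\mathbb{N}$, every weight function $w$, and every accessed element $s\in[n]$, if $h'$ is the height diagram produced by Greedy BST, then \[|\mathrm{stair}_h(s)|\le \Phi_h-\Phi_{h'}+c\Big(1+\log_2\frac{W}{w(s)}\Big).\]
   Context: A height diagram is a function $h:[n]\to\mathbb{N}$. For $a\in[n]$, the stair $\mathrm{stair}_h(a)$ is the set of $b\in[n]$ such that the rectangle $[\min(a,b),\max(a,b)]\times[h(b),\infty)$ contains no point $(b',h(b'))$ with $b'\in[n]$, $b'\neq b$. The neighborhood $N_h(a)$ is the maximal open interval $(x,y)$ of reals (with $x,y\in\mathbb{R}\cup\{\pm\infty\}$) containing $a$ such that no element $b\in[n]\cap(x,y)$ with $b\ne a$ has $h(b)\ge h(a)$. Weights $w:[n]\to\mathbb{R}_{>0}$; for a set $S$ of reals, $w(S)=\sum_{a\in S\cap[n]}w(a)$; $W=w([n])$. The potential is $\Phi_h=\sum_{a\in[n]}\log_2 w(N_h(a))$. A (minimally self-adjusting) geometric BST algorithm, given $h$ and an accessed element $s$, may change only the heights of elements of $\mathrm{stair}_h(s)$, so that in the new diagram $h'$ every element of $\mathrm{stair}_h(s)$ has height strictly greater than every element outside $\mathrm{stair}_h(s)$; the access cost is $|\mathrm{stair}_h(s)|$. Greedy BST sets the heights of all elements of $\mathrm{stair}_h(s)$ to one common value greater than the height of every element outside $\mathrm{stair}_h(s)$ (other heights unchanged). *)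

(* Defs.v *)
From mathcomp Require Import all_boot all_order all_algebra.
From mathcomp Require Import all_classical all_reals all_analysis.
Set Implicit Arguments.
Unset Strict Implicit.
Unset Printing Implicit Defensive.
Import Order.TTheory GRing.Theory Num.Theory.
Local Open Scope classical_set_scope.
Local Open Scope ring_scope.

(* The keys 1, ..., n are represented by the elements 0, ..., n-1 of ['I_n];
   [key] gives the actual position of an element on the real line. *)
Definition key {R : realType} {n : nat} (a : 'I_n) : R := a.+1%:R.

Definition stair (n : nat) (h : 'I_n -> nat) (a : 'I_n) : {set 'I_n} :=
  [set b : 'I_n | ~~ [exists b' : 'I_n,
     [&& b' != b, (minn a b <= b' <= maxn a b)%N & (h b <= h b')%N]]].

Definition ointerval {R : realType} (x y : \bar R) : set R :=
  [set z : R | (x < z%:E)%E /\ (z%:E < y)%E].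

Definition is_ointerval {R : realType} (I : set R) : Prop :=
  exists x y : \bar R, I = ointerval x y.

Definition dominates {R : realType} (n : nat) (h : 'I_n -> nat) (a : 'I_n)
    (I : set R) : Prop :=
  I (key a) /\ ~ (exists b : 'I_n, [/\ b != a, I (key b) & (h a <= h b)%N]).

Definition is_nbhd {R : realType} (n : nat) (h : 'I_n -> nat) (a : 'I_n)
    (I : set R) : Prop :=
  [/\ is_ointerval I, dominates h a I &
      forall J : set R, is_ointerval J -> dominates h a J -> I `<=` J -> J = I].

(* The default value [set0] is never used: see [nbhdP] and [nbhd_unique]. *)
Definition nbhd {R : realType} (n : nat) (h : 'I_n -> nat) (a : 'I_n) : set R :=
  xget set0 (is_nbhd h a).

Definition weight {R : realType} (n : nat) (w : 'I_n -> R) (S : set R) : R :=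
  \sum_(a < n | key a \in S) w a.

Definition total_weight {R : realType} (n : nat) (w : 'I_n -> R) : R :=
  weight w (range (@key R n)).

Definition log2 {R : realType} (x : R) : R := ln x / ln 2.

Definition potential {R : realType} (n : nat) (w : 'I_n -> R)
    (h : 'I_n -> nat) : R :=
  \sum_(a < n) log2 (weight w (nbhd h a)).

(* A relation rather than a function: the common new height [v] may be any
   value exceeding all heights outside the stair. *)
Definition greedy_step (n : nat) (h : 'I_n -> nat) (s : 'I_n)
    (h' : 'I_n -> nat) : Prop :=
  exists v : nat,
    (forall b : 'I_n, b \in stair h s -> h' b = v) /\
    (forall b : 'I_n, b \notin stair h s -> h' b = h b /\ (h b < v)%N).

Lemma greatest_nbhd {R : realType} (n : nat) (h : 'I_n -> nat) (a : 'I_n) :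
  exists I : set R, [/\ is_ointerval I, dominates h a I &
    forall J : set R, is_ointerval J -> dominates h a J -> J `<=` I].
Proof.
pose P (x y : \bar R) := dominates h a (ointerval x y).
pose X := ereal_inf [set x | exists y, P x y].
pose Y := ereal_sup [set y | exists x, P x y].
have leX x y : P x y -> (X <= x)%E by move=> p; apply: ereal_inf_lbound; exists y.
have leY x y : P x y -> (y <= Y)%E by move=> p; apply: ereal_sup_ubound; exists x.
have P0 : P (key a - 1)%:E (key a + 1)%:E.
  split; first by rewrite /ointerval /= !lte_fin ltrBlDr ltrDl ltr01.
  case=> b [ba [+ +] _]; rewrite !lte_fin /key ltrBlDr -!natr1 !ltrD2r.
  rewrite !natr1 !ltr_nat !ltnS => ab bab.
  by move: ba; rewrite -val_eqE /= eqn_leq ab bab.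
exists (ointerval X Y); split; first by exists X, Y.
- split.
    have [[u v] _] := P0; split.
      exact: le_lt_trans (leX _ _ P0) u.
    exact: lt_le_trans v (leY _ _ P0).
  case=> b [ba [Xb bY] hab].
  case: (leP (key b : R) (key a)) => kab.
    have [x [y pxy] xb] := ereal_inf_lt Xb.
    have [[xa ay] no] := pxy; apply: no; exists b; split=> //; split=> //.
    by apply: le_lt_trans ay; rewrite lee_fin.
  have [y [x pxy] yb] := ereal_sup_gt bY.
  have [[xa ay] no] := pxy; apply: no; exists b; split=> //; split=> //.
  by apply: (lt_trans xa); rewrite lte_fin.
- move=> _ [x [y ->]] pxy z [xz zy]; split.
    exact: le_lt_trans (leX _ _ pxy) xz.
  exact: lt_le_trans zy (leY _ _ pxy).
Qed.

Lemma nbhdP {R : realType} (n : nat) (h : 'I_n -> nat) (a : 'I_n) :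
  is_nbhd h a (nbhd h a : set R).
Proof.
have [I [oI dI gI]] := @greatest_nbhd R n h a.
apply: (@xgetPex _ set0 (is_nbhd h a)); exists I; split=> // J oJ dJ IJ.
by apply/seteqP; split=> //; apply: gI.
Qed.

Lemma nbhd_unique {R : realType} (n : nat) (h : 'I_n -> nat) (a : 'I_n)
  (I : set R) : is_nbhd h a I -> I = nbhd h a.
Proof.
have [G [oG dG gG]] := @greatest_nbhd R n h a.
have E (J : set R) : is_nbhd h a J -> J = G.
  by case=> oJ dJ mJ; apply/esym/mJ => //; apply: gG.
by move=> /E ->; rewrite (E _ (nbhdP h a)).
Qed.

(* Main.v *)
(** The neighborhood of [a] consists of the [b] having [a] on their stair. An
    access does not enlarge the neighborhoods of the elements outside the stair [S] of
    [s]; after it, that of [b] in [S] lies strictly between the two elements of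
    [S] next to [b], while before it contained everything from [s] to [b].
    On the right of [s], let [P_i] be the weight from [s] to the [i]-th stair
    element. The potential of that element drops by at least
    [log2 (P_i / (P_(i+1) - P_(i-1))) >= 1 - 2 log2 (P_(i+1) / P_(i-1))],
    and the sum of these telescopes. The left side is symmetric, and the
    potential of [s] itself grows by at most [log2 (W / w s)]. *)
Require Import Defs.
From mathcomp Require Import all_boot all_order all_algebra.
From mathcomp Require Import all_classical all_reals all_analysis.
From mathcomp Require Import ring lra zify.
Set Implicit Arguments.
Unset Strict Implicit.
Unset Printing Implicit Defensive.
Import Order.TTheory GRing.Theory Num.Theory.
Local Open Scope ring_scope.

(** * Inequalities for logarithms to base 2 *)

Lemma log2M (R : realType) (x y : R) : 0 < x -> 0 < y ->
  log2 (x * y) = log2 x + log2 y.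
Proof. by move=> x0 y0; rewrite /log2 lnM ?posrE// mulrDl. Qed.

Lemma log2_div (R : realType) (x y : R) : 0 < x -> 0 < y ->
  log2 (x / y) = log2 x - log2 y.
Proof. by move=> x0 y0; rewrite /log2 ln_div ?posrE// mulrBl. Qed.

Lemma ln2_pos (R : realType) : 0 < ln 2 :> R.
Proof. by apply: ln_gt0; rewrite ltr1n. Qed.

Lemma log2_2 (R : realType) : log2 2 = 1 :> R.
Proof. by rewrite /log2 divff// gt_eqF// ln2_pos. Qed.

Lemma ler_log2 (R : realType) (x y : R) : 0 < x -> x <= y -> log2 x <= log2 y.
Proof.
move=> x0 xy; rewrite /log2 ler_pM2r ?invr_gt0 ?ln2_pos// ler_ln ?posrE//.
exact: lt_le_trans xy.
Qed.

(* [2 (c - a) / p <= 2 (c - a) / a <= (c / a) ^ 2], as [t ^ 2 - 2 t + 2 > 0]. *)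
Lemma log2_gap_le (R : realType) (a c p : R) : 0 < a -> a < c -> a <= p ->
  1 + log2 (c - a) - log2 p <= 2 * (log2 c - log2 a).
Proof.
move=> a0 ac ap.
have c0 : 0 < c by exact: lt_trans ac.
have ca0 : 0 < c - a by rewrite subr_gt0.
have pa := ler_log2 a0 ap.
have : log2 (2 * (c - a) * a) <= log2 (c * c).
  by apply: ler_log2; [rewrite !mulr_gt0|nra].
rewrite !log2M ?mulr_gt0// log2_2; lra.
Qed.

(** * Gaps of a set of keys and how they overlap *)

Definition between (n : nat) (a b c : 'I_n) : bool :=
  (minn a b <= c <= maxn a b)%N.

(* The neighborhood of [b] once all elements of [S] share the greatest height. *)
Definition gap (n : nat) (S : {set 'I_n}) (b : 'I_n) : {set 'I_n} :=
  [set k | [forall c in S, between b k c ==> (c == b)]].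

Lemma gapP (n : nat) (S : {set 'I_n}) (b k : 'I_n) :
  reflect (forall c, c \in S -> between b k c -> c = b) (k \in gap S b).
Proof.
rewrite inE; apply: (iffP forall_inP) => H c cS; last first.
  by apply/implyP => /(H c cS) ->.
by move/implyP: (H c cS) => K /K /eqP.
Qed.

(** The gap is cut off by the elements of [S] nearest to [b] on either side. On the left [s] ensures
    that there is one, and none nearer than [s] is lost. *)
Lemma gap_bounds (n : nat) (S : {set 'I_n}) (s b : 'I_n) :
  s \in S -> b \in S -> (s < b)%N ->
  exists lo hi : nat, [/\ (s <= lo < b)%N, (b < hi <= n)%N &
    forall k : 'I_n, (k \in gap S b) = (lo < k < hi)%N].
Proof.
move=> sS bS sb.
pose P := [pred c : 'I_n | (c \in S) && (c < b)%N].
have Ps : P s by rewrite /= sS.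
case: (arg_maxnP (@nat_of_ord n) Ps) => lo /andP[loS lob] lomax.
(* The value [n] is a sentinel for the case that [S] has no element to the right of [b]. *)
pose Q hi := (b < hi)%N &&
  ((hi == n) || [exists c : 'I_n, (c \in S) && (c == hi :> nat)]).
have exQ : exists hi, Q hi by exists n; rewrite /Q ltn_ord eqxx.
case: (ex_minnP exQ) => hi /andP[bhi hiP] himin.
exists lo, hi; split.
- by rewrite lob andbT; apply: lomax.
- by rewrite bhi; apply: himin; rewrite /Q ltn_ord eqxx.
move=> k; apply/gapP/idP => [H|/andP[lok khi] c cS].
  apply/andP; split; rewrite ltnNge; apply/negP => kle.
    have := H lo loS; rewrite /between.
    have -> : (minn b k <= lo <= maxn b k)%N by lia.
    by move=> /(_ isT) E; move: lob; rewrite E ltnn.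
  move: hiP => /orP[/eqP E|/existsP[c /andP[cS /eqP cE]]].
    by have := ltn_ord k; lia.
  have := H c cS; rewrite /between.
  have -> : (minn b k <= c <= maxn b k)%N by lia.
  by move=> /(_ isT) E; move: bhi; rewrite -cE E ltnn.
rewrite /between => cb; apply: val_inj => /=.
case: (ltngtP c b) => // cltb.
  by have := lomax c; rewrite /P /= cS cltb => /(_ isT); lia.
have := himin c; rewrite /Q cltb /=.
have -> : [exists c0 : 'I_n, (c0 \in S) && (c0 == c :> nat)].
  by apply/existsP; exists c; rewrite cS eqxx.
by rewrite orbT => /(_ isT); lia.
Qed.

(** Of two elements of [S] on the same side of [k], the nearer one lies between [k] and the farther
    one and so excludes [k] from the gap of the latter. This leaves one [b <= k] and one [b > k]. *)
Lemma gap_count (n : nat) (S : {set 'I_n}) (k : 'I_n) :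
  (#|[set b in S | k \in gap S b]| <= 2)%N.
Proof.
have one (A : {set 'I_n}) :
    {in A &, forall x y, x = y} -> (#|A| <= 1)%N.
  by move=> H; apply/card_le1_eqP => x y xA yA; apply: H.
set A := [set _ in _ | _].
rewrite -(cardsID [set b : 'I_n | (b <= k)%N] A) -[2%N]/(1 + 1)%N.
have key (x y : 'I_n) : x \in A -> y \in A -> between x k y -> y = x.
  by move=> /setIdP[_ /gapP H] /setIdP[yS _]; apply: H.
apply: leq_add; apply: one => x y.
  move=> /setIP[xA +] /setIP[yA +]; rewrite !inE => xk yk.
  have [xy|yx] := leqP x y; first by apply/esym/key => //; rewrite /between; lia.
  by apply: key => //; rewrite /between; lia.
move=> /setDP[xA +] /setDP[yA +]; rewrite !inE => xk yk.
have [xy|yx] := leqP x y; first by apply: key => //; rewrite /between; lia.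
by apply/esym/key => //; rewrite /between; lia.
Qed.

(** * Weights of gaps and the telescoping bound on each side of [s] *)

Definition wt (R : realType) (n : nat) (w : 'I_n -> R) (A : {set 'I_n}) : R :=
  \sum_(x in A) w x.

Lemma le_wt (R : realType) (n : nat) (w : 'I_n -> R) (A : {set 'I_n}) x :
  (forall a, 0 < w a) -> x \in A -> w x <= wt w A.
Proof.
move=> w0 xA; rewrite /wt (bigD1 x)//= lerDl sumr_ge0// => *; exact: ltW.
Qed.

Lemma wt_gt0 (R : realType) (n : nat) (w : 'I_n -> R) (A : {set 'I_n}) x :
  (forall a, 0 < w a) -> x \in A -> 0 < wt w A.
Proof. by move=> w0 xA; apply: lt_le_trans (le_wt w0 xA). Qed.

Lemma wt_subset (R : realType) (n : nat) (w : 'I_n -> R) (A B : {set 'I_n}) :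
  (forall a, 0 < w a) -> A \subset B -> wt w A <= wt w B.
Proof.
move=> w0 /fintype.subsetP AB; rewrite /wt [leRHS](bigID (mem A))/=.
rewrite (eq_bigl (fun x => (x \in B) && (x \in A))); last first.
  by move=> x; case: (boolP (x \in A)) => [/AB ->|]; rewrite ?andbF.
by rewrite lerDl sumr_ge0// => *; exact: ltW.
Qed.

(* With [F k] the logarithm of the weight of [s, k), [log2_gap_le] charges to
   each [b] the increments of [F] over its gap; as gaps overlap at most twice,
   the total charge is at most twice the increase of [F]. *)
Lemma sum_gap_right (R : realType) (n : nat) (w : 'I_n -> R)
    (S : {set 'I_n}) (s : 'I_n) :
  (forall a, 0 < w a) -> s \in S ->
  \sum_(b in S | (s < b)%N)
     (1 + log2 (wt w (gap S b)) - log2 (wt w [set k | between s b k])) <=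
  4 * (log2 (wt w [set: 'I_n]) - log2 (w s)).
Proof.
move=> w0 sS.
pose G (k : nat) := wt w [set x : 'I_n | (s <= x < k)%N].
pose F k := log2 (G k).
have G0 k : (s < k)%N -> 0 < G k.
  by move=> sk; apply: (@wt_gt0 _ _ _ _ s) => //; rewrite inE leqnn.
have GM k l : (k <= l)%N -> G k <= G l.
  move=> kl; apply: wt_subset => //; apply/fintype.subsetP => x; rewrite !inE.
  by move=> /andP[-> xk]; apply: leq_trans kl.
have tele lo hi : (lo <= hi <= n)%N ->
    F hi - F lo = \sum_(k < n | (lo <= k < hi)%N) (F k.+1 - F k).
  move=> /andP[lh hn]; rewrite -GRing.telescope_sumr//.
  rewrite (big_nat_widen _ _ n)// big_geq_mkord.
  by apply: eq_bigl => k; rewrite andbC.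
(* [G s] is an empty sum, so [F s] is only a default value of the logarithm; increments are used
   from [s.+1] on. *)
have d0 (k : 'I_n) : (s < k)%N -> 0 <= F k.+1 - F k.
  by move=> sk; rewrite subr_ge0; apply: ler_log2; [exact: G0|exact: GM].
apply: (@le_trans _ _ (\sum_(b in S | (s < b)%N)
    2 * \sum_(k < n | (s < k)%N && (k \in gap S b)) (F k.+1 - F k))).
  apply: ler_sum => b /andP[bS sb].
  have [lo [hi [/andP[slo lob] /andP[bhi hin] gE]]] := gap_bounds sS bS sb.
  rewrite (eq_bigl (fun k : 'I_n => (lo.+1 <= k < hi)%N)); last first.
    by move=> k; rewrite gE; lia.
  rewrite -tele; last by lia.
  have -> : wt w (gap S b) = G hi - G lo.+1.
    apply/eqP; rewrite eq_sym subr_eq; apply/eqP.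
    rewrite /G /wt (bigID (mem (gap S b)))/=; congr (_ + _).
      by apply: eq_bigl => k; rewrite /= gE inE; lia.
    by apply: eq_bigl => k; rewrite /= gE !inE; lia.
  have -> : wt w [set k | between s b k] = G b.+1.
    by apply: eq_bigl => k; rewrite !inE /between; lia.
  (* Here [a], [c] and [p] are the weights of [[s, lo]], [[s, hi)] and [[s, b]]. The strict
     inequality [a < c] holds because [b] lies in the second range but not in the first. *)
  apply: log2_gap_le; [apply: G0; lia| |apply: GM; lia].
  rewrite -subr_gt0.
  apply: (@lt_le_trans _ _ (w b)) => //; rewrite lerBrDr.
  have bG : b \in [set x : 'I_n | (s <= x < hi)%N] by rewrite inE; lia.
  rewrite {2}/G /wt (big_setD1 b bG) lerD2l.
  by apply: wt_subset => //; apply/fintype.subsetP => x; rewrite !inE -val_eqE /=; lia.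
rewrite -mulr_sumr (exchange_big_dep (fun k : 'I_n => (s < k)%N))/=; last first.
  by move=> b k _ /andP[].
(* One factor 2 comes from [log2_gap_le], the other from [gap_count]. *)
have -> : 4 = 2 * 2 :> R by lra.
rewrite -mulrA ler_pM2l//.
apply: (@le_trans _ _ (\sum_(k < n | (s < k)%N) 2 * (F k.+1 - F k))).
  apply: ler_sum => k sk; rewrite sumr_const -[leLHS]mulr_natl.
  apply: ler_wpM2r; first exact: d0.
  rewrite ler_nat; apply: leq_trans (gap_count S k); apply: subset_leq_card.
  apply/fintype.subsetP => b; rewrite unfold_in.
  by move=> /and3P[/andP[bS _] _ kb]; apply/setIdP.
rewrite -mulr_sumr ler_pM2l//.
rewrite (eq_bigl (fun k : 'I_n => (s.+1 <= k < n)%N)); last first.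
  by move=> k; rewrite ltn_ord andbT.
rewrite -tele ?ltn_ord ?leqnn// lerB//.
  apply: ler_log2; [exact: G0|apply: wt_subset => //; exact: finset.subsetT].
by apply: ler_log2 => //; apply: le_wt => //; rewrite inE; lia.
Qed.

(** The reflection [rev_ord] preserves [between], hence gaps, and swaps the two sides of [s]. *)
Lemma sum_gap_left (R : realType) (n : nat) (w : 'I_n -> R)
    (S : {set 'I_n}) (s : 'I_n) :
  (forall a, 0 < w a) -> s \in S ->
  \sum_(b in S | (b < s)%N)
     (1 + log2 (wt w (gap S b)) - log2 (wt w [set k | between s b k])) <=
  4 * (log2 (wt w [set: 'I_n]) - log2 (w s)).
Proof.
move=> w0 sS.
pose S' := [set x | rev_ord x \in S]; pose w' x := w (rev_ord x).
have wtE (A B : {set 'I_n}) :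
    (forall x, (rev_ord x \in A) = (x \in B)) -> wt w A = wt w' B.
  move=> AB; rewrite /wt (reindex_inj rev_ord_inj) /=.
  by apply: eq_bigl => x; rewrite AB.
have btE (a b c : 'I_n) :
    between (rev_ord a) (rev_ord b) (rev_ord c) = between a b c.
  rewrite /between /=; have := (ltn_ord a, ltn_ord b, ltn_ord c).
  by move=> [[]]; lia.
have := @sum_gap_right R n w' S' (rev_ord s) (fun a => w0 _).
rewrite inE rev_ordK => /(_ sS).
rewrite (wtE [set: 'I_n] [set: 'I_n]); last by move=> x; rewrite !inE.
rewrite /w' rev_ordK -/w'; apply: le_trans; rewrite le_eqVlt; apply/orP; left.
apply/eqP; rewrite (reindex_inj rev_ord_inj) /=; apply: eq_big => b.
  by rewrite inE; congr (_ && _); move: (ltn_ord b) (ltn_ord s); lia.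
move=> _; congr (_ + log2 _ - log2 _); apply: wtE => x.
  apply/gapP/gapP => H c cS bt.
    apply: rev_ord_inj; apply: H; first by rewrite inE in cS.
    by rewrite btE.
  apply: rev_ord_inj; rewrite rev_ordK; apply: H.
    by rewrite inE rev_ordK.
  by rewrite -btE rev_ordK.
by rewrite !inE -[in RHS]btE !rev_ordK.
Qed.

(** * Stairs and neighborhoods *)

Lemma mem_stairP (n : nat) (h : 'I_n -> nat) (a b : 'I_n) :
  reflect (forall c, c != b -> between a b c -> (h c < h b)%N)
    (b \in stair h a).
Proof.
rewrite inE negb_exists; apply: (iffP forallP) => H c.
  move=> cb ab; have := H c; rewrite cb -/(between a b c) ab /=.
  by rewrite -ltnNge.
apply/negP => /and3P[cb ab]; apply/negP; rewrite -ltnNge; exact: H.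
Qed.

Lemma key_lt (R : realType) (n : nat) (a b : 'I_n) :
  (key a < key b :> R) = (a < b)%N.
Proof. by rewrite /key ltr_nat ltnS. Qed.

Lemma key_le (R : realType) (n : nat) (a b : 'I_n) :
  (key a <= key b :> R) = (a <= b)%N.
Proof. by rewrite /key ler_nat ltnS. Qed.

(** Both conditions say that no other element from [a] to [b] reaches the height of [a]. This
    replaces real intervals by finite sets. *)
Lemma weight_nbhd (R : realType) (n : nat) (w : 'I_n -> R)
    (h : 'I_n -> nat) (a : 'I_n) :
  weight w (nbhd h a) = wt w [set b | a \in stair h b].
Proof.
apply: eq_bigl => b; rewrite finset.in_set; apply/idP/idP => [/set_mem|st].
  have [[x [y ->]] [[/= xa ay] no] _] := @nbhdP R n h a.
  move=> [/= xb yb].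
  apply/mem_stairP => c ca /andP[c1 c2]; rewrite ltnNge; apply/negP => hac.
  apply: no; exists c; split=> //; split.
    have [ab|ab] := leqP a b.
      by apply: lt_le_trans xa _; rewrite lee_fin key_le; lia.
    by apply: lt_le_trans xb _; rewrite lee_fin key_le; lia.
  have [ab|ab] := leqP a b.
    by apply: le_lt_trans yb; rewrite lee_fin key_le; lia.
  by apply: le_lt_trans ay; rewrite lee_fin key_le; lia.
move/mem_stairP: st => st; apply/mem_set.
have [I [oI dI gI]] := @greatest_nbhd R n h a.
have -> : nbhd h a = I.
  by apply/esym/nbhd_unique; split=> // J oJ dJ IJ; apply/seteqP; split=> //; apply: gI.
(* Since [key c] is [c + 1], this open interval holds exactly the keys from [minn a b] to
   [maxn a b]. *)
pose x : R := (minn a b)%:R; pose y : R := (maxn a b).+2%:R.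
have kJ (c : 'I_n) : ointerval x%:E y%:E (key c) <-> between b a c.
  rewrite /ointerval /= !lte_fin /x /y /key !ltr_nat /between; split.
    by move=> []; lia.
  by move=> ?; split; lia.
apply: (gI (ointerval x%:E y%:E)).
- by exists x%:E, y%:E.
- split; first by apply/kJ; rewrite /between; lia.
  move=> [c [ca /kJ bt hac]]; have := st c ca bt; lia.
- by apply/kJ; rewrite /between; lia.
Qed.

Theorem theorem6 (R : realType) :
  exists c : R,
    forall (n : nat) (h : 'I_n -> nat) (w : 'I_n -> R) (s : 'I_n)
           (h' : 'I_n -> nat),
      (forall a : 'I_n, 0 < w a) ->
      greedy_step h s h' ->
      #|stair h s|%:R <=
        potential w h - potential w h' + c * (1 + log2 (total_weight w / w s)).
Proof.
(* Each side of [s] costs [4 * L], and [s] itself costs [1 + L]. *)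
exists 9 => n h w s h' w0 [v [hS hN]].
pose S := stair h s.
pose A a := wt w [set b | a \in stair h b].
pose B a := wt w [set b | a \in stair h' b].
have memst g (a : 'I_n) : a \in stair g a.
  apply/mem_stairP => c /eqP ca; rewrite /between => bt.
  by case: ca; apply: val_inj => /=; lia.
have A0 a : 0 < A a by apply: (@wt_gt0 _ _ _ _ a) => //; rewrite finset.in_set.
have B0 a : 0 < B a by apply: (@wt_gt0 _ _ _ _ a) => //; rewrite finset.in_set.
have -> : total_weight w = wt w [set: 'I_n].
  by apply: eq_bigl => x; rewrite !inE; apply/asboolP; exists x.
set W := wt w [set: 'I_n].
have WA (X : {set 'I_n}) : wt w X <= W by apply: wt_subset => //; exact: finset.subsetT.
have W0 : 0 < W by apply: (@wt_gt0 _ _ _ _ s) => //; rewrite inE.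
rewrite log2_div//; set L := log2 W - log2 (w s).
have pot g : potential w g = \sum_a log2 (wt w [set b | a \in stair g b]).
  by apply: eq_bigr => a _; rewrite weight_nbhd.
rewrite !pot -sumrB -[X in _ <= X + _]/(\sum_a (log2 (A a) - log2 (B a))).
rewrite (bigID (mem S)) /=.
(* Elements of [S] end up above [a], and the other heights stay, so whatever blocked [a] before
   still blocks it. *)
have out : 0 <= \sum_(a | a \notin S) (log2 (A a) - log2 (B a)).
  apply: sumr_ge0 => a aS; rewrite subr_ge0; apply: ler_log2 => //.
  apply: wt_subset => //; apply/fintype.subsetP => b.
  rewrite finset.in_set => /mem_stairP st; rewrite finset.in_set.
  apply/mem_stairP => c ca bt; have := st c ca bt.
  have [-> av] := hN a aS.
  have [cS|cS] := boolP (c \in S); last by have [-> _] := hN c cS.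
  by rewrite (hS c cS); lia.
have Bgap a : a \in S -> log2 (B a) <= log2 (wt w (gap S a)).
  move=> aS; apply: ler_log2 => //; apply: wt_subset => //.
  apply/fintype.subsetP => b; rewrite finset.in_set => /mem_stairP st.
  apply/gapP => c cS bt; apply/eqP/negP => /negP ca.
  have := st c ca; rewrite (hS a aS) (hS c cS) ltnn.
  by move=> H; suff: false by []; apply: H; move: bt; rewrite /between; lia.
(* Whatever blocks [a] from some [k] between [s] and [a] also blocks it from [s]. *)
have Abt a : a \in S -> log2 (wt w [set k | between s a k]) <= log2 (A a).
  move=> aS; apply: ler_log2.
    by apply: (@wt_gt0 _ _ _ _ s) => //; rewrite inE /between; lia.
  apply: wt_subset => //; apply/fintype.subsetP => k.
  rewrite finset.in_set => bt; rewrite finset.in_set.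
  apply/mem_stairP => c ca btc.
  move/mem_stairP: aS; apply=> //.
  by move: bt btc; rewrite /between; lia.
have sS : s \in S by exact: memst.
have r := sum_gap_right w0 sS; have l := sum_gap_left w0 sS.
have split3 (f : 'I_n -> R) : \sum_(a in S) f a =
    f s + (\sum_(a in S | (s < a)%N) f a + \sum_(a in S | (a < s)%N) f a).
  rewrite (bigD1 s)//=; congr (_ + _).
  rewrite (bigID (fun a : 'I_n => (s < a)%N)) /=.
  by congr (_ + _); apply: eq_bigl => a; rewrite -val_eqE /=; case: (a \in S) => //=; lia.
have cardS : #|S|%:R = \sum_(a in S) 1 :> R by rewrite sumr_const.
have L0 : 0 <= L.
  by rewrite subr_ge0; apply: ler_log2 => //; apply: le_wt; rewrite ?inE.
have As : log2 (w s) <= log2 (A s).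
  by apply: ler_log2 => //; apply: le_wt; rewrite // finset.in_set.
have Bs : log2 (B s) <= log2 W by apply: ler_log2 => //; exact: WA.
suff : #|S|%:R - \sum_(a in S) (log2 (A a) - log2 (B a)) <= 1 + 9 * L.
  by rewrite /S in out *; move: out; lra.
rewrite cardS -sumrB split3.
have cmp (P : pred 'I_n) :
    \sum_(a in S | P a) (1 - (log2 (A a) - log2 (B a))) <=
    \sum_(b in S | P b)
     (1 + log2 (wt w (gap S b)) - log2 (wt w [set k | between s b k])).
  by apply: ler_sum => a /andP[aS _]; have := Bgap a aS; have := Abt a aS; lra.
have := cmp (fun a => (s < a)%N); have := cmp (fun a => (a < s)%N).
rewrite -/W -/L in r l; move: As Bs; rewrite /L in r l *; lra.
Qed.
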